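(* Let $\mathbb P$ be a concept class of generalized propensity scores and $\mathbb D$ a concept class of covariate-outcome distributions. The average treatment effect on the treated $\gamma_{\mathcal D}=\mathbb E_{\mathcal D}[Y(1)-Y(0)\mid T=1]$ is identifiable from the censored distribution $\mathcal C_{\mathcal D}$ over the family of all observational studies $\mathcal D$ realizable with respect to $(\mathbb P,\mathbb D)$ and satisfying $\Pr_{\mathcal D}[T=1]>0$ if and only if $(\mathbb P,\mathbb D)$ satisfies the Identifiability Condition.
   Context: An observational study is a probability distribution $\mathcal D$ of a random tuple $(X,T,Y(0),Y(1))$ with covariates $X\in\mathbb R^d$, treatment $T\in\{0,1\}$ and potential outcomes $Y(0),Y(1)\in\mathbb R$; the joint laws $\mathcal D_{X,Y(t)}$ of $(X,Y(t))$, $t\in\{0,1\}$, are assumed to have densities, and $\mathcal D_X$ denotes the law of $X$. The censored distribution $\mathcal C_{\mathcal D}$ is the law of $(X,T,Y(T))$. The generalized propensity scores of $\mathcal D$ are $p_t(x,y)=\Pr_{\mathcal D}[T=t\mid X=x,Y(t)=y]$, $t\in\{0,1\}$. A concept class of generalized propensity scores is a set $\mathbb P$ of functions $\mathbb R^d\times\mathbb R\to[0,1]$; a concept class of covariate-outcome distributions is a set $\mathbb D$ of probability distributions with densities on $\mathbb R^d\times\mathbb R$; for $\mathcal P\in\mathbb D$, $\mathcal P(x,y)$ denotes its density and $\mathcal P_X$ its marginal on $\mathbb R^d$. $\mathcal D$ is realizable with respect to $(\mathbb P,\mathbb D)$ if $p_0,p_1\in\mathbb P$ and $\mathcal D_{X,Y(0)},\mathcal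 D_{X,Y(1)}\in\mathbb D$. A tuple $(p,\mathcal P)\in\mathbb P\times\mathbb D$ is compatible with $(\mathbb P,\mathbb D)$ if there exist $(\hat p,\hat{\mathcal P})\in\mathbb P\times\mathbb D$ and a valid observational study whose $(p_0,p_1,\mathcal D_{X,Y(0)},\mathcal D_{X,Y(1)})$ equals $(p,\hat p,\mathcal P,\hat{\mathcal P})$ (equivalently, $(\hat p,p,\hat{\mathcal P},\mathcal P)$). A quantity $\eta_{\mathcal D}$ is identifiable from $\mathcal C_{\mathcal D}$ over a family of observational studies if there exists a map $f$ from probability distributions on $\mathbb R^d\times\{0,1\}\times\mathbb R$ to $\mathbb R$ with $f(\mathcal C_{\mathcal D})=\eta_{\mathcal D}$ for every $\mathcal D$ in the family. Identifiability Condition: $(\mathbb P,\mathbb D)$ satisfies it if for any two tuples $(p,\mathcal P),(q,\mathcal Q)\in\mathbb P\times\mathbb D$ that are compatible with $(\mathbb P,\mathbb D)$, at least one of the following holds: (1) $\mathbb E_{(x,y)\sim\mathcal P}[y]=\mathbb E_{(x,y)\sim\mathcal Q}[y]$; (2) $\mathcal P_X\neq\mathcal Q_X$; (3) there exists $(x,y)\in\mathrm{supp}(\mathcal P_X)\times\mathbb R$ with $p(x,y)\mathcal P(x,y)\neq q(x,y)\mathcal Q(x,y)$.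
   Formalization: Condition (3) is taken as: the points of supp(P_X)×R where pP and qQ differ have positive Lebesgue measure (with one point the claim fails after a change on a null set); propensity scores are read up to a.e. versions, and every distribution in D is assumed to have finite E|y|. *)

(* Defs.v *)
From HB Require Import structures.
From mathcomp Require Import all_boot all_order all_algebra.
From mathcomp Require Import all_classical all_reals all_analysis.

Set Implicit Arguments.
Unset Strict Implicit.
Unset Printing Implicit Defensive.
Import Order.TTheory GRing.Theory Num.Theory.

Local Open Scope classical_set_scope.
Local Open Scope ring_scope.

Section ObservationalStudies.
Variable R : realType.
Variable d : nat.

(* Covariates X in R^d are d-tuples of reals (product = Borel sigma-algebra). *)
Definition Cov := (d.-tuple R)%type.
Definition CovOut := (Cov * R)%type.
(* Full observational-study outcome space: (X, T, Y(0), Y(1)); T = true <-> T = 1. *)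
Definition Obs := (Cov * bool * R * R)%type.
(* Censored observation space: (X, T, Y(T)). *)
Definition Cens := (Cov * bool * R)%type.

Definition obsX (o : Obs) : Cov := o.1.1.1.
Definition obsT (o : Obs) : bool := o.1.1.2.
Definition obsY (t : bool) (o : Obs) : R := if t then o.2 else o.1.2.

(* Lebesgue measure on R^n, built as the iterated (Tonelli) product of the
   one-dimensional Lebesgue measure. *)
Fixpoint lebRn (n : nat) : set (n.-tuple R) -> \bar R :=
  match n return set (n.-tuple R) -> \bar R with
  | 0 => fun A => (\1_A [tuple] : R)%:E
  | n'.+1 => fun A =>
      (\int[@lebesgue_measure R]_r @lebRn n' [set t | A (cons_tuple r t)])%E
  end.

Definition lebXY : set CovOut -> \bar R :=
  fun A => (\int[@lebesgue_measure R]_y @lebRn d [set x | A (x, y)])%E.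

Definition is_pdf (P : CovOut -> R) : Prop :=
  measurable_fun [set: CovOut] P /\ (forall z, 0 <= P z) /\
  (\int[lebXY]_z (P z)%:E = 1)%E.

Definition has_density (nu : set CovOut -> \bar R) (P : CovOut -> R) : Prop :=
  forall A, measurable A -> nu A = (\int[lebXY]_(z in A) (P z)%:E)%E.

Definition distr_of (P : CovOut -> R) : set CovOut -> \bar R :=
  fun A => (\int[lebXY]_(z in A) (P z)%:E)%E.

Definition margX (P : CovOut -> R) : set Cov -> \bar R :=
  fun B => distr_of P [set z | B z.1].

Definition mean_y (P : CovOut -> R) : \bar R :=
  (\int[lebXY]_z (z.2 * P z)%:E)%E.

(* Open sup-norm ball in R^d (generates the Euclidean topology). *)
Definition ballRd (x : Cov) (e : R) : set Cov :=
  [set x' | forall i : 'I_d, `|tnth x' i - tnth x i| < e].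

Definition supp (nu : set Cov -> \bar R) : set Cov :=
  [set x | forall e : R, 0 < e -> (0 < nu (ballRd x e))%E].

Definition lawXY (mu : set Obs -> \bar R) (t : bool) : set CovOut -> \bar R :=
  pushforward mu (fun o => (obsX o, obsY t o)).

(* p is (a version of) the generalized propensity score
   p_t(x,y) = Pr[T = t | X = x, Y(t) = y], i.e. the conditional probability
   of the event {T = t} given (X, Y(t)). *)
Definition is_gen_propensity (mu : set Obs -> \bar R) (t : bool)
    (p : CovOut -> R) : Prop :=
  measurable_fun [set: CovOut] p /\ (forall z, 0 <= p z <= 1) /\
  forall A, measurable A ->
    mu [set o | obsT o = t /\ A (obsX o, obsY t o)] =
    (\int[lawXY mu t]_(z in A) (p z)%:E)%E.

Definition study_with (mu : probability Obs R)
    (p0 p1 P0 P1 : CovOut -> R) : Prop :=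
  is_gen_propensity mu false p0 /\ is_gen_propensity mu true p1 /\
  has_density (lawXY mu false) P0 /\ has_density (lawXY mu true) P1.

Definition realizable (PP DD : set (CovOut -> R)) (mu : probability Obs R) : Prop :=
  exists p0 p1 P0 P1, PP p0 /\ PP p1 /\ DD P0 /\ DD P1 /\
    study_with mu p0 p1 P0 P1.

Definition compatible (PP DD : set (CovOut -> R)) (p P : CovOut -> R) : Prop :=
  exists (ph Ph : CovOut -> R) (mu : probability Obs R),
    PP ph /\ DD Ph /\ study_with mu p ph P Ph.

Definition censored (mu : set Obs -> \bar R) : set Cens -> \bar R :=
  pushforward mu (fun o => (obsX o, obsT o, obsY (obsT o) o)).

Definition att (mu : set Obs -> \bar R) : R :=
  fine (\int[mu]_(o in [set o | obsT o = true]) (obsY true o - obsY false o)%:E)%E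
  / fine (mu [set o | obsT o = true]).

Definition att_identifiable (F : set (probability Obs R)) : Prop :=
  exists f : (set Cens -> \bar R) -> R,
    forall mu, F mu -> f (censored mu) = att mu.

(* The Identifiability Condition.  Item (3) is read measure-theoretically:
   p P and q Q differ on a set of positive Lebesgue measure inside
   supp(P_X) x R. *)
Definition identifiability_condition (PP DD : set (CovOut -> R)) : Prop :=
  forall p P q Q, PP p -> DD P -> PP q -> DD Q ->
    compatible PP DD p P -> compatible PP DD q Q ->
    [\/ mean_y P = mean_y Q,
        (exists B, measurable B /\ margX P B <> margX Q B) |
        (0 < lebXY [set z | supp (margX P) z.1 /\
                            (p z * P z)%R <> (q z * Q z)%R])%E].

End ObservationalStudies.

(* Main.v *)
(* Integrating Y(0) over {T = 1} gives E[Y(0)] minus its integral over {T = 0},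
   and the latter, like the integral of Y(1) over {T = 1}, is determined by the
   censored law.  So the censored law identifies the ATT exactly when it
   identifies E[Y(0)].  The part of it on {T = 0} has density p_0 P_0, so two
   studies with the same censored law agree on p_0 P_0 and on the law of X, and
   the condition forces equal means.  Conversely, if (p, P) and (q, Q) violate
   the condition and (p, p1, P, P1) is a study, then (q, p1, Q, P1) is one too,
   with the same censored law, obtained by gluing along X; its ATT differs since
   the mean of Y(0) does. *)
Require Import Defs.
From HB Require Import structures.
From mathcomp Require Import all_boot all_order all_algebra.
From mathcomp Require Import all_classical all_reals all_analysis.
From mathcomp Require Import measurable_realfun.
Set Implicit Arguments.
Unset Strict Implicit.
Unset Printing Implicit Defensive.
Import Order.TTheory GRing.Theory Num.Theory.
Local Open Scope classical_set_scope.
Local Open Scope ring_scope.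

(** The gluing needs no regular conditional laws. On {T = 1} the pair (X, Y(0)) is to receive the
    density (1 - q) Q, so its conditional law given X = x is explicit: that density on the fibre
    over x, divided by its integral. The law of (X, Y(1)) on {T = 1} may then be any finite measure
    with the same X-marginal. Three gaps separate this from the formal statement. Failure of item
    (3) gives p P = q Q a.e. only over the support of the X-marginal, so the complement of a support
    has to be shown null. Compatible tuples may come from studies with Pr[T = 1] = 0, about which
    identifiability says nothing. Finally, [lebXY], [lawXY] and [censored] are bare set functions:
    [lebXY] has to be matched with a product measure on measurable sets, and two censored laws have
    to agree on every set, measurable or not. *)

Section sigma_finite_of.
Context d (T : measurableType d) (R : realType) (m : {measure set T -> \bar R}).
Hypothesis sm : sigma_finite setT m.
Let m' : set T -> \bar R := m.
HB.instance Definition _ := Measure.on m'.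
HB.instance Definition _ := @Measure_isSigmaFinite.Build d T R m' sm.

(** Stated as an existence so that a proof can turn a measure into a sigma-finite one midway and
    then form products with it. *)
Lemma sigma_finite_measure_of :
  exists m' : {sigma_finite_measure set T -> \bar R}, m' = m :> (set T -> \bar R).
Proof. by exists m'. Qed.
End sigma_finite_of.

Section pushforward_measure_of.
Context d d' (T : measurableType d) (U : measurableType d') (R : realType).
Variables (m : {measure set T -> \bar R}) (f : T -> U) (mf : measurable_fun setT f).

Lemma pushforward_measure_of : exists nu : {measure set U -> \bar R},
  nu = pushforward m f :> (set U -> \bar R).
Proof.
unshelve refine (ex_intro _ (pushforward m f : {measure set U -> \bar R}) _) => //.
Qed.
End pushforward_measure_of.

(* [lebesgue_measure] lives on [measurableTypeR R], whose display differs from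
   that of [R]; products with other types are taken with this copy instead. *)
Lemma lebesgue_measure_borel (R : realType) :
  exists lam : {sigma_finite_measure set R -> \bar R},
    forall f : R -> \bar R, measurable_fun setT f -> (forall x, 0 <= f x)%E ->
      (\int[@lebesgue_measure R]_x f x = \int[lam]_x f x)%E.
Proof.
have mid : measurable_fun setT (id : measurableTypeR R -> R) by [].
have [nu nuE] := pushforward_measure_of (@lebesgue_measure R) mid.
have nu_sf : sigma_finite setT nu.
  have [F TF Foo] := sigma_finiteT (@lebesgue_measure R).
  by exists F => // i; rewrite nuE; exact: Foo.
have [lam lamE] := sigma_finite_measure_of nu_sf.
exists lam => f mf f0.
have := ge0_integral_pushforward mid (@lebesgue_measure R) measurableT mf (fun x _ => f0 x).
by rewrite preimage_setT -nuE -lamE => ->.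
Qed.

(** * Lebesgue measure on R^d x R as a sigma-finite product measure *)

Section iterated_lebesgue.
Context (R : realType) (lam : {sigma_finite_measure set R -> \bar R}).
Hypothesis lamE : forall f : R -> \bar R, measurable_fun setT f ->
  (forall x, 0 <= f x)%E -> (\int[@lebesgue_measure R]_x f x = \int[lam]_x f x)%E.

Lemma lebRn_measure n :
  exists m : {sigma_finite_measure set (n.-tuple R) -> \bar R},
    forall A, measurable A -> @lebRn R n A = m A.
Proof.
elim: n => [|n [m IH]].
  exists (@dirac _ (0.-tuple R) [tuple] R).
  by move=> A mA /=; rewrite diracE indicE.
pose c (z : R * n.-tuple R) : n.+1.-tuple R := [the n.+1.-tuple R of z.1 :: z.2].
have mc : measurable_fun setT c by apply: measurable_cons.
have [nu nuE] := pushforward_measure_of (lam \x m)%E mc.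
have nu_sf : sigma_finite setT nu.
  have /sigma_finiteP[F [TF ndF Foo]] := sigma_finiteT lam.
  have /sigma_finiteP[G [TG ndG Goo]] := sigma_finiteT m.
  (* [h] is a measurable left inverse of [c]: the [h]-preimage of a rectangle pulls back along [c]
     to the rectangle itself, so sigma-finiteness passes through the push-forward. *)
  pose h (t : n.+1.-tuple R) := (thead t, [tuple of behead t]).
  have mh : measurable_fun setT h.
    apply/measurable_fun_pairP; split; first exact: measurable_tnth.
    exact: measurable_behead.
  have hc z : h (c z) = z.
    by case: z => a t; rewrite /h/=; congr pair; exact/val_inj.
  exists (fun k => h @^-1` (F k `*` G k)).
    apply/esym; rewrite -subTset => t _.
    have [i _ Fi] : (\bigcup_i F i) (thead t) by rewrite -TF.
    have [j _ Gj] : (\bigcup_i G i) [tuple of behead t] by rewrite -TG.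
    (* Both exhaustions increase, so the larger index serves both coordinates. *)
    exists (maxn i j) => //; split => /=.
      by move: Fi; apply/subsetPset/ndF/leq_maxl.
    by move: Gj; apply/subsetPset/ndG/leq_maxr.
  move=> k; split.
    rewrite -[X in measurable X]setTI; apply: mh => //.
    by apply: measurableX; [exact: (Foo k).1|exact: (Goo k).1].
  rewrite nuE /pushforward.
  have -> : c @^-1` (h @^-1` (F k `*` G k)) = F k `*` G k.
    by rewrite -comp_preimage (_ : h \o c = id) ?preimage_id//; exact/funext.
  have : (lam (F k) * m (G k) < +oo)%E.
    by rewrite lte_mul_pinfty// ?ge0_fin_numE ?(Foo k).2 ?(Goo k).2.
  by rewrite -product_measure1E//; [exact: (Foo k).1|exact: (Goo k).1].
have [m' m'E] := sigma_finite_measure_of nu_sf.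
exists m' => A mA; rewrite m'E nuE /= /pushforward /product_measure1.
have mcA : measurable (c @^-1` A) by rewrite -[X in measurable X]setTI; exact: mc.
rewrite -lamE//; last exact: measurable_fun_xsection.
apply: eq_integral => r _ /=.
have AE : [set t | A (cons_tuple r t)] = xsection (c @^-1` A) r.
  apply/seteqP; split => t; rewrite /xsection/= inE /c/=.
    by congr A; exact/val_inj.
  by congr A; exact/val_inj.
by rewrite AE IH//; exact: measurable_xsection.
Qed.

Lemma lebXY_measure d :
  exists m : {sigma_finite_measure set (Cov R d) -> \bar R},
    forall A, measurable A -> @lebXY R d A = (m \x lam)%E A.
Proof.
have [m mE] := lebRn_measure d; exists m => A mA.
(* [lebXY] integrates over y outermost, which is the form [\x^]; uniqueness of the product measure
   relates it to [\x]. *)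
rewrite (@product_measure_unique _ _ _ _ _ m lam (m \x^ lam)%E)//; last first.
  by move=> B C mB mC; exact: product_measure2E.
rewrite /= /product_measure2 -lamE//; last first.
  by apply: measurable_fun_ysection => //; rewrite inE.
apply: eq_integral => y _ /=.
have AE : [set x | A (x, y)] = ysection A y.
  by apply/seteqP; split => x; rewrite /ysection/= inE.
by rewrite AE mE//; exact: measurable_ysection.
Qed.

End iterated_lebesgue.

(** * Integrals against set functions and against measures with a density *)

Section raw_integral.
Import HBNNSimple.

(** An integral is a difference of suprema over simple functions, whose level sets are measurable,
    so values on other sets never enter. This makes integrals against [lebXY] and [lawXY]
    accessible. *)
Lemma raw_eq_measure_integral d (T : measurableType d) (R : realType)
    (m1 m2 : set T -> \bar R) (D : set T) (f : T -> \bar R) :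
  (forall A, measurable A -> m1 A = m2 A) ->
  (\int[m1]_(x in D) f x = \int[m2]_(x in D) f x)%E.
Proof.
move=> m12; rewrite /integral.
have E (h : {nnsfun T >-> R}) : sintegral m1 h = sintegral m2 h.
  by apply: eq_fsbigr => r _; rewrite m12.
by congr (ereal_sup _ - ereal_sup _)%E; apply/seteqP; split => _ [h ? <-];
  exists h.
Qed.
End raw_integral.

Section integral_density.
Local Open Scope ereal_scope.
Context d (T : measurableType d) (R : realType).
Variables (mu nu : {measure set T -> \bar R}) (P : T -> R).
Hypotheses (mP : measurable_fun setT P) (P0 : forall x, (0 <= P x)%R).
Hypothesis nuE : forall A, measurable A -> nu A = \int[mu]_(x in A) (P x)%:E.

Import HBNNSimple.

Let nnsfun_integral_density (h : {nnsfun T >-> R}) :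
  \int[nu]_x (h x)%:E = \int[mu]_x ((h x)%:E * (P x)%:E).
Proof.
have mPE : measurable_fun setT (EFin \o P) by exact/measurable_EFinP.
have indh0 r t : 0 <= (r * \1_(h @^-1` [set r]) t)%:E by exact: nnfun_muleindic_ge0.
under [RHS]eq_integral => t _.
  rewrite fimfunE -fsumEFin// ge0_mule_fsuml; last by move=> r; exact: indh0.
  over.
rewrite ge0_integral_fsum//; last 2 first.
  - move=> r; apply: emeasurable_funM => //; apply/measurable_EFinP.
    exact: measurable_funM.
  - by move=> r t _; rewrite mule_ge0 ?indh0// lee_fin.
rewrite integralT_nnsfun sintegralE; apply: eq_fsbigr => r; rewrite inE => -[t _ <-].
rewrite nuE// integral_mkcond -ge0_integralZl ?lee_fin//; last 2 first.
  - by apply/(measurable_restrictT _ _).1 => //; exact: measurable_funTS.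
  - by move=> x _; apply: erestrict_ge0 => y _; rewrite lee_fin.
by apply: eq_integral => x _; rewrite epatch_indic/= EFinM -muleA (muleC (P x)%:E).
Qed.

(** Monotone approximation by simple functions, for which the formula is checked level set by level
    set. *)
Lemma ge0_integral_density (D : set T) (f : T -> \bar R) :
  measurable D -> measurable_fun D f -> (forall x, D x -> 0 <= f x) ->
  \int[nu]_(x in D) f x = \int[mu]_(x in D) (f x * (P x)%:E).
Proof.
move=> mD mf f0; rewrite integral_mkcond [RHS]integral_mkcond.
have -> : (fun x => f x * (P x)%:E) \_ D = (fun x => (f \_ D) x * (P x)%:E).
  by apply/funext => x; rewrite !patchE; case: ifP; rewrite ?mul0e.
set g := f \_ D.
have mg : measurable_fun setT g by exact/(measurable_restrictT _ _).1.
have g0 x : 0 <= g x by exact: erestrict_ge0.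
pose h := nnsfun_approx measurableT mg.
have hg x : (h n x)%:E @[n --> \oo] --> g x by exact: cvg_nnsfun_approx.
have ndh x : {homo (fun n => h n x) : m n / (m <= n)%N >-> (m <= n)%R}.
  by move=> m n mn; exact/lefP/nd_nnsfun_approx.
have mPE : measurable_fun setT (EFin \o P) by exact/measurable_EFinP.
transitivity (limn (fun n => \int[nu]_x (h n x)%:E)).
  rewrite -monotone_convergence//.
  - by apply: eq_integral => x _; exact/esym/cvg_lim.
  - by move=> n; exact/measurable_EFinP.
  - by move=> n x _; rewrite lee_fin.
  - by move=> x _ m n mn; rewrite lee_fin; exact: ndh.
under eq_fun do rewrite nnsfun_integral_density.
rewrite -monotone_convergence//.
- apply: eq_integral => x _; apply/cvg_lim => //.
  exact: cvgeZr.
- by move=> n; apply: emeasurable_funM => //; exact/measurable_EFinP.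
- by move=> n x _; rewrite mule_ge0 ?lee_fin.
- by move=> x _ m n mn; rewrite lee_wpmul2r ?lee_fin// ndh.
Qed.

Lemma integral_density (D : set T) (f : T -> \bar R) :
  measurable D -> measurable_fun D f ->
  \int[nu]_(x in D) f x = \int[mu]_(x in D) (f x * (P x)%:E).
Proof.
move=> mD mf; rewrite integralE [RHS]integralE.
(* As [P] is nonnegative, multiplying by it commutes with taking positive and negative parts, which
   reduces the claim to the nonnegative case. *)
have posM (g : T -> \bar R) x :
    maxe (g x * (P x)%:E) 0 = maxe (g x) 0 * (P x)%:E.
  by rewrite maxe_pMl ?lee_fin// mul0e.
rewrite !ge0_integral_density//; [|exact: measurable_funeneg|exact: measurable_funepos].
congr (_ - _); apply: eq_integral => x _.
  by rewrite !funeposE posM.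
by rewrite !funenegE -(posM (fun x => - f x)) mulNe.
Qed.

End integral_density.

(** * The support of a measure on R^d *)

Section support.
Context (R : realType) (d : nat).

Lemma measurable_ballRd (x : Cov R d) (e : R) : measurable (ballRd x e).
Proof.
have -> : ballRd x e = \bigcap_(i in [set: 'I_d])
    ((fun t => tnth t i) @^-1` [set a | `|a - tnth x i| < e]).
  by apply/seteqP; split => [t xt i _|t xt i]; exact: xt.
apply: fin_bigcap_measurable => // i _.
rewrite -[X in measurable X]setTI; apply: measurable_tnth => //.
rewrite (_ : [set a | _] = [set` `]tnth x i - e, tnth x i + e[]).
  exact: measurable_itv.
by apply/seteqP; split => a /=; rewrite in_itv/= ltr_distl.
Qed.

Lemma ballRd_inner (x y : Cov R d) (e : R) :
  ballRd x e y -> 0 < e -> exists2 r, 0 < r & ballRd y r `<=` ballRd x e.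
Proof.
(* The slack of the tightest coordinate; the default [e] keeps the radius positive when d = 0. *)
move=> xy e0; pose r := \big[Order.min/e]_(i < d) (e - `|tnth y i - tnth x i|).
exists r; first by apply/bigmin_gtP; split => // i _; rewrite subr_gt0; exact: xy.
move=> z yz i; have : r <= e - `|tnth y i - tnth x i| by exact: bigmin_le_cond.
rewrite lerBrDr => re; apply: lt_le_trans re.
rewrite (le_lt_trans (ler_distD (tnth y i) _ _))// ltrD2r; exact: yz.
Qed.

Variable nu : {measure set (Cov R d) -> \bar R}.

Let ratball (k : nat) : set (Cov R d) :=
  if @unpickle ((d.-tuple rat) * nat)%type k is Some (q, n) then
    ballRd [tuple of map ratr q] n.+1%:R^-1
  else set0.

Let nullball k := if nu (ratball k) == 0%E then ratball k else set0.

Let measurable_nullball k : measurable (nullball k).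
Proof.
rewrite /nullball; case: ifP => // _; rewrite /ratball.
by case: unpickle => [[q n]|//]; exact: measurable_ballRd.
Qed.

(** A point outside the support has a null ball of radius [e], which contains a ball of rational
    centre and radius below [e / 2] around that point; conversely a null ball contains a smaller
    ball about each of its points. The union being countable, the complement is both measurable and
    null. *)
Let setC_supp : ~` supp nu = \bigcup_k nullball k.
Proof.
apply/seteqP; split => x.
  move=> /existsNP[e /not_implyP[e0 /negP]]; rewrite -leNgt measure_le0 => /eqP xe.
  have [n ne] : exists n : nat, n.+1%:R^-1 < e / 2.
    have e20 : 0 < e / 2 by rewrite divr_gt0.
    exists (Num.truncn (e / 2)^-1).
    by rewrite invf_plt ?posrE// Num.Theory.truncnS_gt.
  have qP i : {q : rat | `|tnth x i - ratr q| < n.+1%:R^-1}.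
    have : tnth x i - n.+1%:R^-1 < tnth x i + n.+1%:R^-1.
      by rewrite ltrD2l gtrN// invr_gt0.
    move=> /rat_in_itvoo/cid[q]; rewrite in_itv/= => /andP[q1 q2].
    by exists q; rewrite distrC ltr_distl q1 q2.
  pose q : d.-tuple rat := [tuple sval (qP i) | i < d].
  have tnthq i : tnth [tuple of map ratr q] i = ratr (sval (qP i)) :> R.
    by rewrite tnth_map tnth_mktuple.
  have ballq : ratball (pickle (q, n)) = ballRd [tuple of map ratr q] n.+1%:R^-1.
    by rewrite /ratball pickleK.
  exists (pickle (q, n)) => //; rewrite /nullball.
  suff -> : nu (ratball (pickle (q, n))) = 0%E.
    rewrite eqxx ballq => i; rewrite tnthq; exact: (svalP (qP i)).
  apply/eqP; rewrite -measure_le0 -xe ballq le_measure ?inE//;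
    [exact: measurable_ballRd|exact: measurable_ballRd|].
  move=> y qy i; rewrite (splitr e).
  rewrite (le_lt_trans (ler_distD (ratr (sval (qP i))) _ _))//.
  apply: ltrD.
    by apply: lt_trans ne; move: (qy i); rewrite tnthq.
  by rewrite distrC; apply: lt_trans ne; exact: (svalP (qP i)).
move=> [k _]; rewrite /nullball; case: ifPn => // /eqP; rewrite /ratball.
case: unpickle => [[q n]|//] qn0 qx xsupp.
have [|r r0 rq] := ballRd_inner qx; first by rewrite invr_gt0.
have := xsupp r r0; apply/negP; rewrite -leNgt -qn0.
by rewrite le_measure ?inE//; exact: measurable_ballRd.
Qed.

Lemma measurable_supp : measurable (supp nu).
Proof.
rewrite -[supp nu]setCK setC_supp; apply: measurableC.
exact: bigcup_measurable.
Qed.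

Lemma measure_setC_supp : nu (~` supp nu) = 0%E.
Proof.
rewrite setC_supp; apply: measure_negligible; first exact: bigcup_measurable.
apply: negligible_bigcup => k; exists (nullball k); split => //.
by rewrite /nullball; case: ifP => // /eqP.
Qed.

End support.

(** * Laws of the potential outcomes under a study *)

Section study.
Local Open Scope ereal_scope.
Context (R : realType) (d : nat).

Lemma measurable_obsX : measurable_fun setT (@obsX R d).
Proof.
exact: (measurableT_comp measurable_fst (measurableT_comp measurable_fst measurable_fst)).
Qed.

Lemma measurable_obsT : measurable_fun setT (@obsT R d).
Proof.
exact: (measurableT_comp measurable_snd (measurableT_comp measurable_fst measurable_fst)).
Qed.

Lemma measurable_obsY t : measurable_fun setT (@obsY R d t).
Proof.
case: t; first exact: measurable_snd.
exact: (measurableT_comp measurable_snd measurable_fst).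
Qed.

Lemma measurable_obsXY t : measurable_fun setT (fun o : Obs R d => (obsX o, obsY t o)).
Proof.
apply/measurable_fun_pairP; split; [exact: measurable_obsX|exact: measurable_obsY].
Qed.

Lemma measurable_treated t : measurable [set o : Obs R d | obsT o = t].
Proof.
rewrite (_ : [set o | _] = setT `&` @obsT R d @^-1` [set t]) ?setTI//.
by rewrite -[X in measurable X]setTI; exact: measurable_obsT.
Qed.

Lemma measurable_treatedXY t A : measurable A ->
  measurable [set o : Obs R d | obsT o = t /\ A (obsX o, obsY t o)].
Proof.
move=> mA; apply: measurableI; first exact: measurable_treated.
by rewrite -[X in measurable X]setTI; exact: measurable_obsXY.
Qed.

Lemma measurable_censored_event t A : measurable A ->
  measurable [set w : Cens R d | w.1.2 = t /\ A (w.1.1, w.2)].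
Proof.
have mX : measurable_fun setT (fun w : Cens R d => (w.1.1, w.2)).
  apply/measurable_fun_pairP; split; last exact: measurable_snd.
  exact: (measurableT_comp measurable_fst measurable_fst).
have mT : measurable_fun setT (fun w : Cens R d => w.1.2).
  exact: (measurableT_comp measurable_snd measurable_fst).
move=> mA; rewrite -[X in measurable X]setTI.
rewrite (_ : [set w | _] = (fun w : Cens R d => w.1.2) @^-1` [set t] `&`
  (fun w : Cens R d => (w.1.1, w.2)) @^-1` A)//.
rewrite setIIr; apply: measurableI; [exact: mT|exact: mX].
Qed.

Lemma measurable_censor :
  measurable_fun setT (fun o : Obs R d => (obsX o, obsT o, obsY (obsT o) o)).
Proof.
apply/measurable_fun_pairP; split => /=.
  apply/measurable_fun_pairP; split; [exact: measurable_obsX|exact: measurable_obsT].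
rewrite [X in measurable_fun _ X](_ : _ =
    (fun o => if obsT o then obsY true o else obsY false o)).
  apply: measurable_fun_ifT; [exact: measurable_obsT|exact: measurable_obsY..].
by apply/funext => o /=; case: (obsT o).
Qed.

Variables (lam : {sigma_finite_measure set R -> \bar R})
  (m : {sigma_finite_measure set (Cov R d) -> \bar R}).
Hypothesis lebXYE : forall A, measurable A -> @lebXY R d A = (m \x lam) A.

Lemma integral_lebXY D f : \int[@lebXY R d]_(z in D) f z = \int[m \x lam]_(z in D) f z.
Proof. exact: raw_eq_measure_integral. Qed.

Variable mu : probability (Obs R d) R.
Variables (t : bool) (P : CovOut R d -> R).
Hypothesis pdfP : is_pdf P.
Hypothesis PE : has_density (lawXY mu t) P.

Let mP : measurable_fun setT P. Proof. by case: pdfP. Qed.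
Let P0 z : (0 <= P z)%R. Proof. by case: pdfP => _ []. Qed.

Lemma lawXY_density A : measurable A ->
  lawXY mu t A = \int[m \x lam]_(z in A) (P z)%:E.
Proof. by move=> mA; rewrite PE// integral_lebXY. Qed.

Lemma ge0_integral_lawXY D f : measurable D -> measurable_fun D f ->
  (forall z, D z -> 0 <= f z) ->
  \int[lawXY mu t]_(z in D) f z = \int[m \x lam]_(z in D) (f z * (P z)%:E).
Proof.
have [nu nuE] := pushforward_measure_of mu (measurable_obsXY t).
have -> : lawXY mu t = nu by [].
apply: ge0_integral_density => // A mA; rewrite nuE; exact: lawXY_density.
Qed.

Lemma integral_lawXY D f : measurable D -> measurable_fun D f ->
  \int[lawXY mu t]_(z in D) f z = \int[m \x lam]_(z in D) (f z * (P z)%:E).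
Proof.
have [nu nuE] := pushforward_measure_of mu (measurable_obsXY t).
have -> : lawXY mu t = nu by [].
apply: integral_density => // A mA; rewrite nuE; exact: lawXY_density.
Qed.

Lemma propensity_density p A : is_gen_propensity mu t p -> measurable A ->
  mu [set o | obsT o = t /\ A (obsX o, obsY t o)] =
  \int[m \x lam]_(z in A) (p z * P z)%:E.
Proof.
move=> [mp [p01 pE]] mA; rewrite pE// ge0_integral_lawXY//.
  by apply: measurable_funTS; exact/measurable_EFinP.
by move=> z _; rewrite lee_fin; case/andP: (p01 z).
Qed.

Hypothesis intP : \int[@lebXY R d]_z (`|z.2| * P z)%:E < +oo.

Lemma integrable_obsY : mu.-integrable setT (EFin \o @obsY R d t).
Proof.
apply/integrableP; split; first by apply/measurable_EFinP; exact: measurable_obsY.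
move: intP; rewrite integral_lebXY; apply: le_lt_trans.
have mabs : measurable_fun setT (fun z : CovOut R d => (`|z.2|)%:E).
  apply/measurable_EFinP; apply: measurableT_comp => //; exact: measurable_snd.
have := ge0_integral_lawXY measurableT mabs.
rewrite (ge0_integral_pushforward (measurable_obsXY t)) => // <-.
- by [].
- by move=> z _; rewrite lee_fin.
Qed.

Lemma mean_yE : mean_y P = \int[mu]_o (obsY t o)%:E.
Proof.
rewrite /mean_y integral_lebXY.
have msnd : measurable_fun setT (fun z : CovOut R d => z.2%:E).
  by apply/measurable_EFinP; exact: measurable_snd.
have := integral_lawXY measurableT msnd.
rewrite (integral_pushforward (measurable_obsXY t))//.
exact: integrable_obsY.
Qed.

End study.

(** * The ATT in terms of the censored law and E[Y(0)] *)

Section att.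
Local Open Scope ereal_scope.
Context (R : realType) (d : nat).

(** A functional of the law [c] alone, so that equal censored laws give equal values by
    rewriting. *)
Definition censored_mean (c : set (Cens R d) -> \bar R) (t : bool) : \bar R :=
  \int[c]_(w in [set w | w.1.2 = t]) (w.2)%:E.

Variable mu : probability (Obs R d) R.
Let E t := [set o : Obs R d | obsT o = t].

Lemma integral_observed t : mu.-integrable setT (EFin \o @obsY R d t) ->
  \int[mu]_(o in E t) (obsY t o)%:E = censored_mean (censored mu) t.
Proof.
move=> iY.
have mt : measurable [set w : Cens R d | w.1.2 = t].
  rewrite (_ : [set w | _] = [set w | w.1.2 = t /\ setT (w.1.1, w.2)]).
    exact: measurable_censored_event.
  by apply/seteqP; split => w //= [].
have msnd : measurable_fun setT (fun w : Cens R d => (w.2)%:E).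
  by apply/measurable_EFinP; exact: measurable_snd.
rewrite /censored_mean (integral_pushforward (@measurable_censor R d))//.
  by apply: eq_integral => o; rewrite inE => /= ->.
(* The censored outcome is known to coincide with Y(t) only over {T = t}, so integrability is
   transferred on that set. *)
apply: (@eq_integrable _ _ _ mu (E t) (measurable_treated t) (EFin \o @obsY R d t)).
  by move=> o; rewrite inE => /= ->.
by apply: integrableS iY => //; exact: measurable_treated.
Qed.

Lemma integral_obsY_split t : mu.-integrable setT (EFin \o @obsY R d t) ->
  \int[mu]_o (obsY t o)%:E =
  censored_mean (censored mu) t + \int[mu]_(o in E (~~ t)) (obsY t o)%:E.
Proof.
move=> iY; rewrite -integral_observed//.
have -> : [set: Obs R d] = E t `|` E (~~ t).
  apply/esym; rewrite -subTset => o _; rewrite /E/=.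
  by case: (obsT o) t {iY} => -[]; [left|right|right|left].
rewrite integral_setU//.
- exact: measurable_treated.
- exact: measurable_treated.
- by apply: measurable_funTS; exact: measurable_int iY.
- by apply/disj_set2P/seteqP; split => // o []; rewrite /E/= => -> /esym; case: (t).
Qed.

(** The mean of Y(0) is the only term not read off the censored law. Integrability keeps all
    integrals finite, so that [fine] commutes with sums and differences. *)
Lemma attE : mu.-integrable setT (EFin \o @obsY R d true) ->
  mu.-integrable setT (EFin \o @obsY R d false) ->
  att mu = ((fine (censored_mean (censored mu) true) -
             (fine (\int[mu]_o (obsY false o)%:E) -
              fine (censored_mean (censored mu) false))) /
            fine (censored mu [set w | w.1.2 = true]))%R.
Proof.
move=> i1 i0; rewrite /att; congr (_ / _)%R.
have mE t : measurable (E t) by exact: measurable_treated.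
have iE s t : mu.-integrable setT (EFin \o @obsY R d t) ->
    mu.-integrable (E s) (EFin \o @obsY R d t).
  by apply: integrableS => //; exact: mE.
under eq_integral do rewrite EFinB.
rewrite integralB_EFin//; [|exact: mE|exact: iE|exact: iE].
rewrite fineB ?integrable_fin_num//; [|exact: mE|exact: iE|exact: mE|exact: iE].
rewrite integral_observed//; congr (_ - _)%R.
have fE s : \int[mu]_(o in E s) (obsY false o)%:E \is a fin_num.
  by apply: integrable_fin_num; [exact: mE|exact: iE].
rewrite integral_obsY_split// -(@integral_observed false)//.
by rewrite (fineD (fE false) (fE true)) addrAC subrr add0r.
Qed.

End att.

(** * From the Identifiability Condition to identifiability *)

Section condition_to_identifiability.
Local Open Scope ereal_scope.
Context (R : realType) (d : nat).
Variables (lam : {sigma_finite_measure set R -> \bar R})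
  (m : {sigma_finite_measure set (Cov R d) -> \bar R}).
Hypothesis lebXYE : forall A, measurable A -> @lebXY R d A = (m \x lam) A.

Lemma margXE (mu : probability (Obs R d) R) t P B :
  has_density (lawXY mu t) P -> measurable B -> margX P B = mu (@obsX R d @^-1` B).
Proof.
move=> PE mB; rewrite /margX /distr_of -PE//.
rewrite (_ : [set z | _] = fst @^-1` B)// -[X in measurable X]setTI.
exact: measurable_fst.
Qed.

(** [margX P] is a bare set function, so the claim is proved for the law of X under [mu] and
    transferred: the two agree on balls, hence have the same support. *)
Lemma margX_supp (mu : probability (Obs R d) R) t P :
  has_density (lawXY mu t) P ->
  measurable (supp (margX P)) /\ margX P (~` supp (margX P)) = 0.
Proof.
move=> PE; have [nu nuE] := pushforward_measure_of mu (@measurable_obsX R d).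
have PnuE B : measurable B -> margX P B = nu B.
  by move=> mB; rewrite (margXE PE)// nuE.
have -> : supp (margX P) = supp nu.
  by apply/seteqP; split => x xs e /xs; rewrite PnuE//; exact: measurable_ballRd.
split; first exact: measurable_supp.
by rewrite PnuE ?measure_setC_supp//; apply: measurableC; exact: measurable_supp.
Qed.

Lemma measurable_supp_neq (S : set (Cov R d)) (f g : CovOut R d -> R) :
  measurable S -> measurable_fun setT f -> measurable_fun setT g ->
  measurable [set z | S z.1 /\ f z <> g z].
Proof.
move=> mS mf mg.
rewrite (_ : [set z | _] = fst @^-1` S `&` (f \- g)%R @^-1` (~` [set 0%R])); last first.
  apply/seteqP; split => z /= [Sz fg]; split => // fgz; apply: fg.
    exact: subr0_eq.
  by rewrite fgz subrr.
apply: measurableI; rewrite -[X in measurable X]setTI.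
  exact: measurable_fst.
by apply: measurable_funB => //; exact: measurableC.
Qed.

Lemma propensity_censored (mu : probability (Obs R d) R) t (A : set (CovOut R d)) :
  mu [set o | obsT o = t /\ A (obsX o, obsY t o)] =
  censored mu [set w | w.1.2 = t /\ A (w.1.1, w.2)].
Proof.
by congr (mu _); apply/seteqP; split => o /= [<-].
Qed.

(** Both products are densities of the {T = t} part of one censored law. Its mass is at most 1,
    which makes [p P] integrable, and equal integrals over all measurable sets then force equality
    a.e. *)
Lemma observed_density_unique (mu mu' : probability (Obs R d) R) t p P q Q :
  is_pdf P -> has_density (lawXY mu t) P -> is_gen_propensity mu t p ->
  is_pdf Q -> has_density (lawXY mu' t) Q -> is_gen_propensity mu' t q ->
  (forall A, measurable A -> censored mu A = censored mu' A) ->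
  lebXY [set z | supp (margX P) z.1 /\ (p z * P z)%R <> (q z * Q z)%R] = 0.
Proof.
move=> pdfP PE pp pdfQ QE qq cE.
have mpP : measurable_fun setT (fun z => p z * P z)%R.
  by apply: measurable_funM; [case: pp|case: pdfP].
have mqQ : measurable_fun setT (fun z => q z * Q z)%R.
  by apply: measurable_funM; [case: qq|case: pdfQ].
have [msupp _] := margX_supp PE.
have mS := measurable_supp_neq msupp mpP mqQ.
rewrite lebXYE//.
have pPE := propensity_density lebXYE pdfP PE pp.
have qQE := propensity_density lebXYE pdfQ QE qq.
have : ae_eq (m \x lam) setT (fun z => (p z * P z)%:E) (fun z => (q z * Q z)%:E).
  apply: integral_ae_eq => //.
  - apply/integrableP; split; first exact/measurable_EFinP.
    rewrite (eq_integral (fun z => (p z * P z)%:E)); last first.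
      move=> z _; rewrite /= ger0_norm// mulr_ge0//.
        by case: pp => _ [/(_ z)/andP[]].
      by case: pdfP => _ [].
    rewrite -pPE//; apply: le_lt_trans (probability_le1 _ _) (ltry _).
    exact: measurable_treatedXY.
  - exact/measurable_EFinP.
  - move=> A _ mA; rewrite -pPE// -qQE// !propensity_censored cE//.
    exact: measurable_censored_event.
move=> [N [mN N0 SN]]; apply/eqP; rewrite -measure_le0 -N0.
apply: le_measure; rewrite ?inE// => z [_ pq]; apply: SN => /= /(_ Logic.I).
by move=> [].
Qed.

Lemma condition_identifiable (PP DD : set (CovOut R d -> R)) :
  (forall P, DD P -> is_pdf P) ->
  (forall P, DD P -> \int[@lebXY R d]_z (`|z.2| * P z)%:E < +oo) ->
  identifiability_condition PP DD ->
  att_identifiable [set mu : probability (Obs R d) R |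
    realizable PP DD mu /\ 0 < mu [set o | obsT o = true]].
Proof.
move=> pdfD intD IC.
pose F := [set mu : probability (Obs R d) R |
    realizable PP DD mu /\ 0 < mu [set o | obsT o = true]].
(* [f] is defined by choice on each fibre of [censored]: the ATT of some study in [F] with that law,
   and 0 if there is none. It is correct once the ATT is constant on fibres. *)
suff attU mu mu' : F mu -> F mu' -> censored mu = censored mu' -> att mu = att mu'.
  exists (fun c => if pselect (exists2 mu, F mu & censored mu = c) is left h
                   then att (s2val (cid2 h)) else 0%R).
  move=> mu Fmu; case: pselect => [h|[]]; last by exists mu.
  by case: cid2 => mu' /= Fmu' cE; exact: attU.
move=> [[p0 [p1 [P0 [P1 [p0PP [p1PP [P0D [P1D [pp0 [pp1 [PE0 PE1]]]]]]]]]]] _].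
move=> [[q0 [q1 [Q0 [Q1 [q0PP [q1PP [Q0D [Q1D [qq0 [qq1 [QE0 QE1]]]]]]]]]]] _] cE.
have iP0 := integrable_obsY lebXYE (pdfD _ P0D) PE0 (intD _ P0D).
have iP1 := integrable_obsY lebXYE (pdfD _ P1D) PE1 (intD _ P1D).
have iQ0 := integrable_obsY lebXYE (pdfD _ Q0D) QE0 (intD _ Q0D).
have iQ1 := integrable_obsY lebXYE (pdfD _ Q1D) QE1 (intD _ Q1D).
rewrite !attE// cE.
rewrite -(mean_yE lebXYE (pdfD _ P0D) PE0 (intD _ P0D)).
rewrite -(mean_yE lebXYE (pdfD _ Q0D) QE0 (intD _ Q0D)).
suff -> : mean_y P0 = mean_y Q0 by [].
have cP : compatible PP DD p0 P0 by exists p1, P1, mu.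
have cQ : compatible PP DD q0 Q0 by exists q1, Q1, mu'.
have [//|[B [mB]]|] := IC _ _ _ _ p0PP P0D q0PP Q0D cP cQ.
- case; rewrite (margXE PE0)// (margXE QE0)//.
  (* Testing the censored laws on the event that the covariate lies in [B] recovers the law of X. *)
  by have := congr1 (fun c => c [set w : Cens R d | B w.1.1]) cE.
- rewrite (observed_density_unique (pdfD _ P0D) PE0 pp0 (pdfD _ Q0D) QE0 qq0) ?ltxx//.
  by move=> A _; rewrite cE.
Qed.

End condition_to_identifiability.

(** * Gluing two measures along a common marginal *)

Lemma density_measure_of d (T : measurableType d) (R : realType)
    (mu : {measure set T -> \bar R}) (f : T -> \bar R) :
  measurable_fun setT f -> (forall x, 0 <= f x)%E ->
  exists nu : {measure set T -> \bar R}, forall A, nu A = (\int[mu]_(x in A) f x)%E.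
Proof.
move=> mf f0; pose n (A : set T) := (\int[mu]_(x in A) f x)%E.
have n0 : n set0 = 0%E by rewrite /n integral_set0.
have nge0 A : (0 <= n A)%E by exact: integral_ge0.
have nadd : semi_sigma_additive n by exact: semi_sigma_additive_nng_induced.
pose H := isMeasure.Build d T R n n0 nge0 nadd.
pose nu : {measure set T -> \bar R} := HB.pack n H.
by exists nu.
Qed.

Section glue.
Local Open Scope ereal_scope.
Context d1 d2 d3 (T1 : measurableType d1) (T2 : measurableType d2)
  (T3 : measurableType d3) (R : realType).
Variables (m : {sigma_finite_measure set T1 -> \bar R})
  (lam : {sigma_finite_measure set T3 -> \bar R}) (a : T1 * T3 -> R).
Hypotheses (ma : measurable_fun setT a) (a0 : forall z, (0 <= a z)%R).

Let mEa : measurable_fun setT (EFin \o a). Proof. exact/measurable_EFinP. Qed.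
Let Ea0 z : 0 <= (EFin \o a) z. Proof. by rewrite lee_fin. Qed.

(** The mass that the density [a (x, .)] gives to the fibre of [C] over [x]; thus [M] is the
    density, with respect to [m], of the first marginal of [a]. *)
Let H (C : set (T1 * T3)) x := \int[lam]_y ((EFin \o a) \_ C) (x, y).
Let M := H setT.
Let fM x := fine (M x).

Let mres C : measurable C -> measurable_fun setT ((EFin \o a) \_ C).
Proof.
by move=> mC; apply/(measurable_restrictT _ _).1 => //; exact: measurable_funTS.
Qed.

Let res0 C z : 0 <= ((EFin \o a) \_ C) z. Proof. exact: erestrict_ge0. Qed.

Let mH C : measurable C -> measurable_fun setT (H C).
Proof. by move=> mC; exact: (measurable_fun_fubini_tonelli_F _ (mres mC)). Qed.

Let H0 C x : 0 <= H C x. Proof. by apply: integral_ge0 => y _; exact: res0. Qed.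

Let HM C x : measurable C -> H C x <= M x.
Proof.
move=> mC; apply: ge0_le_integral => //.
- by apply: measurable_fun_pair2; exact: mres.
- by apply: measurable_fun_pair2; exact: mres.
- move=> y _; rewrite !patchE in_setT; case: ifP => // _; exact: Ea0.
Qed.

Let integral_H C : measurable C -> \int[m \x lam]_(z in C) (a z)%:E = \int[m]_x H C x.
Proof.
move=> mC; rewrite integral_mkcond.
exact: (@fubini_tonelli1 _ _ _ _ _ m lam ((EFin \o a) \_ C) (mres mC) (res0 C)).
Qed.

Let mfM : measurable_fun setT fM.
Proof. by apply: measurableT_comp => //; exact: mH. Qed.

Let fM0 x : (0 <= fM x)%R. Proof. exact/fine_ge0/H0. Qed.

Let c (w : T1 * T3) : R := (a w / fM w.1)%R.

Let mc : measurable_fun setT c.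
Proof.
rewrite (_ : c = fun w => (a w * (fM w.1) `^ (-1))%R); last first.
  by apply/funext => w; rewrite /c powR_inv1.
apply: measurable_funM => //; apply: (measurableT_comp (measurable_powR _)).
exact: (measurableT_comp mfM measurable_fst).
Qed.

Let c0 w : (0 <= c w)%R. Proof. by rewrite /c divr_ge0. Qed.

Let integral_c C x : measurable C ->
  \int[lam]_y ((EFin \o c) \_ C) (x, y) = H C x * (fM x)^-1%:E.
Proof.
move=> mC; rewrite -ge0_integralZr ?lee_fin ?invr_ge0//.
- by apply: eq_integral => y _; rewrite !patchE; case: ifP; rewrite ?mul0e.
- by apply: measurable_fun_pair2; exact: mres.
Qed.

Variable nu : {measure set (T1 * T2) -> \bar R}.
Hypothesis nuoo : nu setT < +oo.
Hypothesis nuE : forall B, measurable B ->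
  nu (fst @^-1` B) = \int[m \x lam]_(z in fst @^-1` B) (a z)%:E.

Let m1 B : measurable B -> measurable (fst @^-1` B : set (T1 * T3)).
Proof. by move=> mB; rewrite -[X in measurable X]setTI; exact: measurable_fst. Qed.

Let m1' B : measurable B -> measurable (fst @^-1` B : set (T1 * T2)).
Proof. by move=> mB; rewrite -[X in measurable X]setTI; exact: measurable_fst. Qed.

(** The integral of [M] is the total mass of [nu], which is finite; hence [fine] alters [M] only on
    an [m]-null set. *)
Let M_fin : {ae m, forall x, M x \is a fin_num}.
Proof.
have iM : m.-integrable setT M.
  apply/integrableP; split; first exact: mH.
  rewrite (eq_integral M); last by move=> x _; rewrite gee0_abs// H0.
  by rewrite -integral_H// -[X in \int[_]_(_ in X) _]/(fst @^-1` setT) -nuE.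
by apply: filterS (integrable_ae measurableT iM) => x; exact.
Qed.

Let nu_fst B : measurable B ->
  nu (fst @^-1` B) = \int[m]_(x in B) (fM x)%:E.
Proof.
move=> mB; rewrite nuE// integral_H//; last exact: m1.
rewrite [RHS]integral_mkcond; apply: ge0_ae_eq_integral => //.
- by apply: mH; exact: m1.
- apply/(measurable_restrictT _ _).1 => //; apply/measurable_funTS.
  exact/measurable_EFinP.
- by move=> x _; apply: erestrict_ge0 => y _; rewrite lee_fin.
- apply: filterS M_fin => x Mx _; rewrite patchE; case: ifPn => xB.
    rewrite fineK//; apply: eq_integral => y _.
    by rewrite !patchE in_setT; case: ifPn => // /negP[]; rewrite inE/= -inE.
  apply: integral0_eq => y _; rewrite patchE; case: ifPn => //.
  by rewrite inE/= -inE => xB'; rewrite xB' in xB.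
Qed.

Let nu_fM0 : nu [set w | fM w.1 = 0%R] = 0.
Proof.
have mB : measurable (fM @^-1` [set 0%R]).
  by rewrite -[X in measurable X]setTI; exact: mfM.
rewrite (_ : [set w | _] = fst @^-1` (fM @^-1` [set 0%R]))// nu_fst//.
by apply: integral0_eq => x /= ->.
Qed.

(* The fibre law of the glued measure given [x] is [a (x, .) / fM x]; the junk
   value [_ / 0 = 0] only matters on a [nu]-null set. *)
Lemma glue_conditionally_independent :
  exists G : {measure set ((T1 * T2) * T3) -> \bar R},
    (forall A, measurable A -> G [set w | A w.1] = nu A) /\
    (forall C, measurable C ->
      G [set w | C (w.1.1, w.2)] = \int[m \x lam]_(z in C) (a z)%:E).
Proof.
have nu_sf : sigma_finite setT nu.
  apply: fin_num_fun_sigma_finite; first by rewrite measure0.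
  move=> A mA; rewrite ge0_fin_numE//; apply: le_lt_trans nuoo.
  by rewrite le_measure ?inE.
have [nu' nu'E] := sigma_finite_measure_of nu_sf.
pose g (w : (T1 * T2) * T3) := (c (w.1.1, w.2))%:E.
have mg : measurable_fun setT g.
  apply/measurable_EFinP; apply: (measurableT_comp mc).
  apply/measurable_fun_pairP; split; last exact: measurable_snd.
  exact: (measurableT_comp measurable_fst measurable_fst).
have g0 w : 0 <= g w by rewrite lee_fin.
have [G GE] := density_measure_of (nu' \x lam) mg g0.
(* Both marginals are read off this formula, with [C] full for the first and [A] full for the
   second. *)
have GE2 (A : set (T1 * T2)) (C : set (T1 * T3)) : measurable A -> measurable C ->
    G [set w | A w.1 /\ C (w.1.1, w.2)] =
    \int[nu]_(w in A) (H C w.1 * (fM w.1)^-1%:E).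
  move=> mA mC; set D := [set w | _].
  have mD : measurable D.
    apply: measurableI; rewrite -[X in measurable X]setTI; first exact: measurable_fst.
    suff : measurable_fun setT (fun w : (T1 * T2) * T3 => (w.1.1, w.2)) by exact.
    apply/measurable_fun_pairP; split; last exact: measurable_snd.
    exact: (measurableT_comp measurable_fst measurable_fst).
  have mgD : measurable_fun setT (g \_ D).
    by apply/(measurable_restrictT _ _).1 => //; exact: measurable_funTS.
  have gD0 w : 0 <= (g \_ D) w by exact: erestrict_ge0.
  rewrite GE integral_mkcond.
  have -> := @fubini_tonelli1 _ _ _ _ _ nu' lam _ mgD gD0.
  rewrite nu'E [RHS]integral_mkcond; apply: eq_integral => w _.
  rewrite patchE; case: ifPn => wA.
    rewrite -integral_c//; apply: eq_integral => y _; rewrite !patchE.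
    have -> : ((w, y) \in D) = ((w.1, y) \in C).
      by apply/idP/idP; rewrite !inE /D/=; [case|split; first exact: set_mem].
    by [].
  apply: integral0_eq => y _; rewrite patchE; case: ifPn => //.
  by move=> /set_mem[Aw _]; case/negP: wA; exact: mem_set.
have mk C : measurable C -> measurable_fun setT (fun x => H C x * (fM x)^-1%:E).
  move=> mC; apply: emeasurable_funM; first exact: mH.
  apply/measurable_EFinP; rewrite (_ : (fun x => _) = fun x => (fM x `^ (-1))%R).
    exact: (measurableT_comp (measurable_powR _)).
  by apply/funext => x; rewrite powR_inv1.
have k0 C x : 0 <= H C x * (fM x)^-1%:E by rewrite mule_ge0 ?lee_fin ?invr_ge0.
have mk1 C : measurable C ->
    measurable_fun setT (fun w : T1 * T2 => H C w.1 * (fM w.1)^-1%:E).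
  by move=> mC; exact: (measurableT_comp (mk C mC) measurable_fst).
exists G; split=> [A mA|C mC].
  rewrite (_ : [set w | A w.1] = [set w | A w.1 /\ setT (w.1.1, w.2)]); last first.
    by apply/seteqP; split => w //= [].
  (* For full [C] the integrand is [M / fM], equal to 1 off the [nu]-null set where [fM]
     vanishes. *)
  rewrite GE2// -[RHS]mul1e -integral_cst//; apply: ge0_ae_eq_integral => //.
  - by apply: measurable_funTS; exact: mk1.
  - exists [set w | fM w.1 = 0%R]; split => //.
      rewrite (_ : [set w | _] = fst @^-1` (fM @^-1` [set 0%R]))//.
      by apply: m1'; rewrite -[X in measurable X]setTI; exact: mfM.
    move=> w /= /not_implyP[_]; apply: contra_notP => fMw.
    (* An infinite [M] has [fine] equal to 0 and so falls into the exceptional set as well. *)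
    have Mfin : M w.1 \is a fin_num.
      by apply/negPn/negP => /fin_numPn[] Mw; apply: fMw; rewrite /fM Mw.
    by rewrite -/M -(fineK Mfin) -EFinM divff//; exact/eqP.
rewrite (_ : [set w | C _] = [set w | setT w.1 /\ C (w.1.1, w.2)]); last first.
  by apply/seteqP; split => w //= [].
rewrite GE2// integral_H//.
have [nuX nuXE] := pushforward_measure_of nu (@measurable_fst _ _ T1 T2).
transitivity (\int[nuX]_x (H C x * (fM x)^-1%:E)).
  rewrite nuXE (ge0_integral_pushforward (@measurable_fst _ _ T1 T2))//.
  exact: mk.
(* The first marginal of [nu] has density [fM], which cancels the denominator. *)
rewrite (@ge0_integral_density _ _ _ m nuX fM)//; last 2 first.
  - by move=> B mB; rewrite nuXE; exact: nu_fst.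
  - exact: mk.
apply: ge0_ae_eq_integral => //.
- by apply: emeasurable_funM; [exact: mk|exact/measurable_EFinP].
- exact: mH.
- by move=> x _; rewrite mule_ge0 ?lee_fin.
- apply: filterS M_fin => x Mx _; rewrite -muleA -EFinM.
  (* Where [fM x = 0] the left side is 0, and [H C x <= M x = 0] makes the right side 0 too. *)
  have [fMx|fMx] := eqVneq (fM x) 0%R; last by rewrite mulVf// mule1.
  have /eqP : M x = 0 by rewrite -(fineK Mx) -/(fM x) fMx.
  rewrite fMx mulr0 mule0 => /eqP Mx0.
  by apply/eqP; rewrite eq_le H0 -Mx0 HM.
Qed.

End glue.

(* Values on non-measurable sets are visible to [censored], so they have to be
   normalised before two censored laws can coincide as functions on all sets. *)
Lemma probability_measurable_only d (T : measurableType d) (R : realType)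
    (mu : {measure set T -> \bar R}) : mu setT = 1%E ->
  exists mu' : probability T R,
    (forall A, measurable A -> mu' A = mu A) /\
    (forall A, ~ measurable A -> mu' A = 0%E).
Proof.
move=> mu1; pose n (A : set T) : \bar R := if asbool (measurable A) then mu A else 0%E.
have nE A : measurable A -> n A = mu A by move=> mA; rewrite /n asboolT.
have n0 : n set0 = 0%E by rewrite nE.
have nge0 A : (0 <= n A)%E by rewrite /n; case: ifP.
have nadd : semi_sigma_additive n.
  move=> F mF tF mUF; rewrite nE//.
  rewrite (_ : (fun k => _) = (fun k => \sum_(0 <= i < k) mu (F i))%E).
    exact: measure_semi_sigma_additive.
  by apply/funext => k; apply: eq_bigr => i _; rewrite nE.
have n1 : n setT = 1%E by rewrite nE.
pose H := isMeasure.Build d T R n n0 nge0 nadd.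
pose nm : {measure set T -> \bar R} := HB.pack n H.
pose H1 := Measure_isProbability.Build d T R nm n1.
pose np : probability T R := HB.pack (nm : set T -> \bar R) H H1.
exists np; split => A mA; first exact: nE.
by rewrite /np/= /n asboolF.
Qed.

(** * Rebuilding a study on the treated population *)

Section glued_study.
Local Open Scope ereal_scope.
Context (R : realType) (d : nat).
Variables (lam : {sigma_finite_measure set R -> \bar R})
  (m : {sigma_finite_measure set (Cov R d) -> \bar R}).

Lemma treated_split (mu : {measure set (Obs R d) -> \bar R}) S : measurable S ->
  mu S = mu [set o | obsT o = false /\ S o] + mu [set o | obsT o = true /\ S o].
Proof.
move=> mS; rewrite -measureU.
- congr (mu _); apply/seteqP; split => o /=; last by case=> -[].
  by move=> So; case: (obsT o); [right|left].
- by apply: measurableI => //; exact: measurable_treated.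
- by apply: measurableI => //; exact: measurable_treated.
- by apply/seteqP; split => o //= [[->] _ [//]].
Qed.

(** [mu] is kept on {T = 0} and replaced by a glued measure on {T = 1}. The first equation concerns
    the observed outcomes, the other two the unobserved ones; together they determine the laws of
    (X, Y(0)) and (X, Y(1)). *)
Lemma glued_study (mu : probability (Obs R d) R) (a : CovOut R d -> R) :
  measurable_fun setT a -> (forall z, (0 <= a z)%R) ->
  (forall B, measurable B -> mu [set o | obsT o = true /\ B (obsX o)] =
     \int[m \x lam]_(z in fst @^-1` B) (a z)%:E) ->
  exists mu' : {measure set (Obs R d) -> \bar R},
   [/\ forall t A, measurable A ->
         mu' [set o | obsT o = t /\ A (obsX o, obsY t o)] =
         mu [set o | obsT o = t /\ A (obsX o, obsY t o)],
       forall A, measurable A ->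
         mu' [set o | obsT o = false /\ A (obsX o, obsY true o)] =
         mu [set o | obsT o = false /\ A (obsX o, obsY true o)] &
       forall A, measurable A ->
         mu' [set o | obsT o = true /\ A (obsX o, obsY false o)] =
         \int[m \x lam]_(z in A) (a z)%:E].
Proof.
move=> ma a0 muE.
pose mu0 := mrestr mu (@measurable_treated R d false).
pose mu1 := mrestr mu (@measurable_treated R d true).
have [nu nuE] := pushforward_measure_of mu1 (@measurable_obsXY R d true).
have nuT : nu setT < +oo.
  rewrite nuE /pushforward preimage_setT /mu1/= /mrestr setTI.
  by apply: le_lt_trans (probability_le1 _ _) (ltry _); exact: measurable_treated.
have nuX B : measurable B ->
    nu (fst @^-1` B) = \int[m \x lam]_(z in fst @^-1` B) (a z)%:E.
  move=> mB; rewrite -muE// nuE /pushforward /mu1/= /mrestr.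
  by congr (mu _); apply/seteqP; split => o /= [].
have [G [G1 G2]] := glue_conditionally_independent ma a0 nuT nuX.
(* The glued space has the order ((x, Y(1)), Y(0)), since gluing puts the coordinate with a density
   last. *)
pose s (w : (Cov R d * R) * R) : Obs R d := (w.1.1, true, w.2, w.1.2).
have ms : measurable_fun setT s.
  apply/measurable_fun_pairP; split => /=; last first.
    exact: (measurableT_comp measurable_snd measurable_fst).
  apply/measurable_fun_pairP; split => /=; last exact: measurable_snd.
  apply/measurable_fun_pairP; split => /=; last exact: measurable_cst.
  exact: (measurableT_comp measurable_fst measurable_fst).
have [G' G'E] := pushforward_measure_of G ms.
have [mu' addE] : exists mu' : {measure set (Obs R d) -> \bar R}, forall S,
    mu' S = mu (S `&` [set o | obsT o = false]) + G (s @^-1` S).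
  by exists (measure_add mu0 G') => S; rewrite [LHS]measure_addE G'E.
exists mu'.
have G0 A t : G (s @^-1` [set o | obsT o = false /\ A (obsX o, obsY t o)]) = 0.
  by rewrite (_ : s @^-1` _ = set0) ?measure0//; apply/seteqP; split => w // [].
have mu0E A t : mu ([set o | obsT o = false /\ A (obsX o, obsY t o)] `&`
      [set o | obsT o = false]) =
    mu [set o | obsT o = false /\ A (obsX o, obsY t o)].
  by congr (mu _); apply/seteqP; split => o /= [] // [].
have mu1E A t : mu ([set o | obsT o = true /\ A (obsX o, obsY t o)] `&`
      [set o | obsT o = false]) = 0.
  by rewrite (_ : _ `&` _ = set0) ?measure0//; apply/seteqP; split => o //= [[->]].
split.
- move=> [] A mA; last by rewrite addE mu0E G0 adde0.
  rewrite addE mu1E add0e.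
  rewrite (_ : s @^-1` _ = [set w | A w.1]); last first.
    by apply/seteqP; split => -[[x y1] y0] //= [].
  rewrite G1// nuE /pushforward /mu1/= /mrestr.
  by congr (mu _); apply/seteqP; split => o /= [].
- by move=> A mA; rewrite addE mu0E G0 adde0.
- move=> A mA; rewrite addE mu1E add0e.
  rewrite (_ : s @^-1` _ = [set w | A (w.1.1, w.2)]) ?G2//.
  by apply/seteqP; split => -[[x y1] y0] //= [].
Qed.

End glued_study.

(** * From identifiability to the Identifiability Condition *)

Section identifiability_to_condition.
Local Open Scope ereal_scope.
Context (R : realType) (d : nat).
Variables (lam : {sigma_finite_measure set R -> \bar R})
  (m : {sigma_finite_measure set (Cov R d) -> \bar R}).
Hypothesis lebXYE : forall A, measurable A -> @lebXY R d A = (m \x lam) A.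

(** Lets a study be normalised off the measurable sets: its scores and densities are tested on
    measurable events only. *)
Lemma study_with_eq (mu mu' : probability (Obs R d) R) p0 p1 P0 P1 :
  (forall A, measurable A -> mu' A = mu A) ->
  study_with mu p0 p1 P0 P1 -> study_with mu' p0 p1 P0 P1.
Proof.
move=> muE.
have lawE t A : measurable A -> lawXY mu' t A = lawXY mu t A.
  move=> mA; apply: muE; rewrite -[X in measurable X]setTI.
  exact: measurable_obsXY.
have gpE t p : is_gen_propensity mu t p -> is_gen_propensity mu' t p.
  move=> [mp [p01 pE]]; split=> //; split=> // A mA.
  rewrite muE; last exact: measurable_treatedXY.
  by rewrite pE//; apply: raw_eq_measure_integral => B mB; rewrite lawE.
move=> [pp0 [pp1 [PE0 PE1]]]; split; first exact: gpE.
split; first exact: gpE.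
by split=> A mA; rewrite lawE//; [exact: PE0|exact: PE1].
Qed.

(** If the preimage of [A] is not measurable, both sides are 0; otherwise [A] is measurable itself
    and its preimage splits along T into events covered by the third hypothesis. *)
Lemma censored_eq (mu mu' : probability (Obs R d) R) :
  (forall A, ~ measurable A -> mu A = 0) -> (forall A, ~ measurable A -> mu' A = 0) ->
  (forall t A, measurable A -> mu [set o | obsT o = t /\ A (obsX o, obsY t o)] =
                               mu' [set o | obsT o = t /\ A (obsX o, obsY t o)]) ->
  censored mu = censored mu'.
Proof.
move=> nmu nmu' muE; apply/funext => A; rewrite /censored /pushforward.
set S := _ @^-1` A.
have [mS|mS] := pselect (measurable S); last by rewrite nmu// nmu'.
have mA : measurable A.
  (* A section of the censoring map: writing the observed value into both potential outcomes
     recovers [A] as a measurable preimage of [S]. *)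
  pose s (w : Cens R d) : Obs R d := (w.1.1, w.1.2, w.2, w.2).
  have ms : measurable_fun setT s.
    apply/measurable_fun_pairP; split => /=; last exact: measurable_snd.
    apply/measurable_fun_pairP; split => /=; last exact: measurable_snd.
    by rewrite [X in measurable_fun _ X](_ : _ = fst)//; apply/funext => -[[]].
  rewrite (_ : A = s @^-1` S).
    by rewrite -[X in measurable X]setTI; exact: ms.
  by apply/seteqP; split => -[[x []] y].
have mt t : measurable [set z : CovOut R d | A (z.1, t, z.2)].
  have mf : measurable_fun setT (fun z : CovOut R d => (z.1, t, z.2)).
    apply/measurable_fun_pairP; split => /=; last exact: measurable_snd.
    apply/measurable_fun_pairP; split => /=; last exact: measurable_cst.
    exact: measurable_fst.
  by rewrite -[X in measurable X]setTI; exact: mf.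
have SE t : [set o | obsT o = t /\ S o] =
    [set o | obsT o = t /\ [set z : CovOut R d | A (z.1, t, z.2)] (obsX o, obsY t o)].
  by apply/seteqP; split => o /= [<-].
rewrite (treated_split mu mS) (treated_split mu' mS) (SE false) (SE true).
by congr (_ + _); [exact: muE (mt false)|exact: muE (mt true)].
Qed.

Lemma ae_eq0_margX_supp (mu : probability (Obs R d) R) t P :
  is_pdf P -> has_density (lawXY mu t) P ->
  {ae m \x lam, forall z, ~ supp (margX P) z.1 -> P z = 0%R}.
Proof.
move=> [mP [P0 _]] PE; have [ms s0] := margX_supp PE.
have mN : measurable [set z : CovOut R d | ~ supp (margX P) z.1].
  rewrite (_ : [set z | _] = fst @^-1` (~` supp (margX P)))//.
  rewrite -[X in measurable X]setTI; apply: measurable_fst => //.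
  exact: measurableC.
have mEP : measurable_fun [set z : CovOut R d | ~ supp (margX P) z.1] (EFin \o P).
  by apply: measurable_funTS; exact/measurable_EFinP.
have := (ae_eq_integral_abs (m \x lam) mN mEP).1.
rewrite (eq_integral (fun z => (P z)%:E)); last first.
  by move=> z _; rewrite gee0_abs// lee_fin.
rewrite -(integral_lebXY lebXYE) => /(_ s0).
by apply: filterS => z + /[dup] Nz => /(_ Nz)[].
Qed.

Section alternative.
Variables (mu mu' : probability (Obs R d) R) (p ph P Ph q qh Q Qh : CovOut R d -> R).
Hypotheses (pdfP : is_pdf P) (pdfQ : is_pdf Q).
Hypotheses (sP : study_with mu p ph P Ph) (sQ : study_with mu' q qh Q Qh).
Hypothesis margE : forall B, measurable B -> margX P B = margX Q B.
Hypothesis pPqQ :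
  lebXY [set z | supp (margX P) z.1 /\ (p z * P z)%R <> (q z * Q z)%R] = 0.

Let mp : measurable_fun setT p. Proof. by case: sP => -[]. Qed.
Let mq : measurable_fun setT q. Proof. by case: sQ => -[]. Qed.
Let p01 z : (0 <= p z <= 1)%R. Proof. by case: sP => -[_ []]. Qed.
Let q01 z : (0 <= q z <= 1)%R. Proof. by case: sQ => -[_ []]. Qed.
Let mP : measurable_fun setT P. Proof. by case: pdfP. Qed.
Let mQ : measurable_fun setT Q. Proof. by case: pdfQ. Qed.
Let P0 z : (0 <= P z)%R. Proof. by case: pdfP => _ []. Qed.
Let Q0 z : (0 <= Q z)%R. Proof. by case: pdfQ => _ []. Qed.
Let PE : has_density (lawXY mu false) P. Proof. by case: sP => _ [_ []]. Qed.
Let QE : has_density (lawXY mu' false) Q. Proof. by case: sQ => _ [_ []]. Qed.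

(** [pPqQ] gives the equality a.e. over the support only. Off it [P] and [Q] both vanish a.e., since
    equal X-marginals have the same support. *)
Lemma integral_observed_eq A : measurable A ->
  \int[m \x lam]_(z in A) (p z * P z)%:E = \int[m \x lam]_(z in A) (q z * Q z)%:E.
Proof.
move=> mA; have mpP : measurable_fun setT (fun z => p z * P z)%R by exact: measurable_funM.
have mqQ : measurable_fun setT (fun z => q z * Q z)%R by exact: measurable_funM.
have [ms _] := margX_supp PE.
have mS := measurable_supp_neq ms mpP mqQ.
have suppE : supp (margX P) = supp (margX Q).
  by apply/seteqP; split => x xs e /xs; rewrite margE//; exact: measurable_ballRd.
apply: ge0_ae_eq_integral => //.
- by apply: measurable_funTS; exact/measurable_EFinP.
- by apply: measurable_funTS; exact/measurable_EFinP.
- by move=> z _; rewrite lee_fin mulr_ge0//; case/andP: (p01 z).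
- by move=> z _; rewrite lee_fin mulr_ge0//; case/andP: (q01 z).
have aeP := ae_eq0_margX_supp pdfP PE.
have aeQ := ae_eq0_margX_supp pdfQ QE.
have aeS : {ae m \x lam, forall z, supp (margX P) z.1 -> (p z * P z = q z * Q z)%R}.
  exists [set z | supp (margX P) z.1 /\ (p z * P z)%R <> (q z * Q z)%R].
  by split=> //; [rewrite -lebXYE|move=> z /= /not_implyP].
apply: filterS3 aeP aeQ aeS => z zP zQ zS _; congr EFin.
have [/zS //|Nz] := pselect (supp (margX P) z.1).
by rewrite zP// zQ ?mulr0// -suppE.
Qed.

(* Replacing [(p, P)] by [(q, Q)] while keeping [(ph, Ph)]: on [T = 0] the new
   study is [mu] itself, on [T = 1] it couples [(X, Y(1))] under [mu] with
   [(X, Y(0))] of density [(1 - q) Q], conditionally independently given [X]. *)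
Lemma swapped_study : exists mu1 mu2 : probability (Obs R d) R,
  [/\ study_with mu1 p ph P Ph, study_with mu2 q ph Q Ph &
      censored mu1 = censored mu2].
Proof.
pose a z := ((1 - q z) * Q z)%R.
have ma : measurable_fun setT a.
  by apply: measurable_funM => //; exact: measurable_funB.
have a0 z : (0 <= a z)%R by rewrite mulr_ge0// subr_ge0; case/andP: (q01 z).
have qQ0 z : (0 <= q z * Q z)%R by rewrite mulr_ge0//; case/andP: (q01 z).
have mqQ : measurable_fun setT (fun z => q z * Q z)%R by exact: measurable_funM.
have aqQ A : measurable A -> \int[m \x lam]_(z in A) (q z * Q z)%:E +
    \int[m \x lam]_(z in A) (a z)%:E = \int[m \x lam]_(z in A) (Q z)%:E.
  move=> mA; rewrite -ge0_integralD//.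
  - apply: eq_integral => z _; rewrite -EFinD -mulrDl addrC subrK mul1r//.
  - by move=> z _; rewrite lee_fin.
  - by apply: measurable_funTS; exact/measurable_EFinP.
  - by move=> z _; rewrite lee_fin.
  - by apply: measurable_funTS; exact/measurable_EFinP.
have observedE A : measurable A ->
    mu [set o | obsT o = false /\ A (obsX o, obsY false o)] =
    \int[m \x lam]_(z in A) (q z * Q z)%:E.
  move=> mA; rewrite -integral_observed_eq//.
  by apply: (propensity_density lebXYE) => //; case: sP.
have mfst B : measurable B -> measurable (fst @^-1` B : set (CovOut R d)).
  by move=> mB; rewrite -[X in measurable X]setTI; exact: measurable_fst.
(* The gluing hypothesis: the {T = 0} part, finite and common to both sides, is subtracted from the
   common law of X. *)
have treatedE B : measurable B -> mu [set o | obsT o = true /\ B (obsX o)] =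
     \int[m \x lam]_(z in fst @^-1` B) (a z)%:E.
  move=> mB; have mXB : measurable (@obsX R d @^-1` B).
    by rewrite -[X in measurable X]setTI; exact: measurable_obsX.
  have : mu (@obsX R d @^-1` B) = \int[m \x lam]_(z in fst @^-1` B) (Q z)%:E.
    rewrite -(margXE PE)// margE// (margXE QE)//.
    have -> : mu' (@obsX R d @^-1` B) = lawXY mu' false (fst @^-1` B) by [].
    by apply: (lawXY_density lebXYE) => //; exact: mfst.
  have obsB := observedE _ (mfst B mB).
  have fin : mu [set o | obsT o = false /\ (fst @^-1` B) (obsX o, obsY false o)]
      \is a fin_num.
    by apply: fin_num_measure; apply: measurable_treatedXY; exact: mfst.
  have addI (c x y : \bar R) : c \is a fin_num -> c + x = c + y -> x = y.
    by case: c x y => [c| |] [x| |] [y| |] //= _ [] /addrI ->.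
  rewrite (treated_split mu mXB) -aqQ; last exact: mfst.
  by rewrite -obsB; exact: (addI _ _ _ fin).
have [nu [nuE nu01 nu10]] := glued_study ma a0 treatedE.
have mXY t s A : measurable A ->
    measurable [set o : Obs R d | obsT o = t /\ A (obsX o, obsY s o)].
  move=> mA; apply: measurableI; first exact: measurable_treated.
  by rewrite -[X in measurable X]setTI; exact: measurable_obsXY.
have mlaw s A : measurable A ->
    measurable [set o : Obs R d | A (obsX o, obsY s o)].
  by move=> mA; rewrite -[X in measurable X]setTI; exact: measurable_obsXY.
have nuT : nu setT = 1.
  rewrite (treated_split nu measurableT) -(probability_setT mu).
  rewrite [RHS](treated_split mu measurableT).
  by rewrite (nuE false setT measurableT) (nuE true setT measurableT).
(* [mu] itself is normalised too, since its values on non-measurable sets could otherwise differ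
   from those of the new study. *)
have [mu1 [mu1E mu1N]] := probability_measurable_only (probability_setT mu).
have [mu2 [mu2E mu2N]] := probability_measurable_only nuT.
exists mu1, mu2; split.
- exact: study_with_eq sP.
(* The {T = 0} part contributes [q Q] and the glued part [(1 - q) Q], which add up to [Q]. *)
- have law0 A : measurable A ->
      lawXY mu2 false A = \int[m \x lam]_(z in A) (Q z)%:E.
    move=> mA; rewrite /lawXY /pushforward mu2E; last exact: mlaw.
    rewrite (treated_split nu (mlaw false A mA)).
    by rewrite (nuE false A mA) (nu10 A mA) observedE// aqQ.
  have law1 A : measurable A -> lawXY mu2 true A = lawXY mu true A.
    move=> mA; rewrite /lawXY /pushforward mu2E; last exact: mlaw.
    rewrite (treated_split nu (mlaw true A mA)) (treated_split mu (mlaw true A mA)).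
    by rewrite (nuE true A mA) (nu01 A mA).
  have QE2 : has_density (lawXY mu2 false) Q.
    by move=> A mA; rewrite (integral_lebXY lebXYE) law0.
  split.
    split=> //; split=> // A mA; rewrite mu2E; last exact: mXY.
    rewrite nuE// observedE// (ge0_integral_lawXY lebXYE pdfQ QE2)//.
      by apply: measurable_funTS; exact/measurable_EFinP.
    by move=> z _; rewrite lee_fin; case/andP: (q01 z).
  case: sP => _ [[mph [ph01 phE]] [_ PhE]].
  split; last by split => // A mA; rewrite law1// PhE.
  split=> //; split=> // A mA; rewrite mu2E; last exact: mXY.
  by rewrite nuE// phE//; apply: raw_eq_measure_integral => B mB; rewrite law1.
- apply: censored_eq => // t A mA.
  by rewrite mu1E; [rewrite mu2E; [rewrite nuE|exact: mXY]|exact: mXY].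
Qed.

End alternative.

Lemma identifiable_condition (PP DD : set (CovOut R d -> R)) :
  (forall P, DD P -> is_pdf P) ->
  (forall P, DD P -> \int[@lebXY R d]_z (`|z.2| * P z)%:E < +oo) ->
  att_identifiable [set mu : probability (Obs R d) R |
    realizable PP DD mu /\ 0 < mu [set o | obsT o = true]] ->
  identifiability_condition PP DD.
Proof.
move=> pdfD intD [f fE] p P q Q PPp DDP PPq DDQ.
move=> [ph [Ph [mu [PPph [DDPh sP]]]]] [qh [Qh [mu' [_ [_ sQ]]]]].
have [?|meanN] := pselect (mean_y P = mean_y Q); first exact: Or31.
have [?|margN] := pselect (exists B, measurable B /\ margX P B <> margX Q B).
  exact: Or32.
have [?|pPN] := boolP (0 < lebXY [set z | supp (margX P) z.1 /\
    (p z * P z)%R <> (q z * Q z)%R]); first exact: Or33.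
exfalso.
have margE B : measurable B -> margX P B = margX Q B.
  by move=> mB; apply: contrapT => BN; apply: margN; exists B.
have PE : has_density (lawXY mu false) P by case: sP => _ [_ []].
have pPqQ : lebXY [set z | supp (margX P) z.1 /\ (p z * P z)%R <> (q z * Q z)%R] = 0.
  have [ms _] := margX_supp PE.
  have mS : measurable [set z | supp (margX P) z.1 /\ (p z * P z)%R <> (q z * Q z)%R].
    apply: measurable_supp_neq => //; apply: measurable_funM.
    - by case: sP => -[].
    - by case: (pdfD _ DDP).
    - by case: sQ => -[].
    - by case: (pdfD _ DDQ).
  by apply/eqP; move: pPN; rewrite lebXYE// -leNgt measure_le0.
have [mu1 [mu2 [s1 s2 cE]]] :=
  swapped_study (pdfD _ DDP) (pdfD _ DDQ) sP sQ margE pPqQ.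
have [_ [_ [PE1 PhE1]]] := s1; have [_ [_ [QE2 PhE2]]] := s2.
have i10 := integrable_obsY lebXYE (pdfD _ DDP) PE1 (intD _ DDP).
have i11 := integrable_obsY lebXYE (pdfD _ DDPh) PhE1 (intD _ DDPh).
have i20 := integrable_obsY lebXYE (pdfD _ DDQ) QE2 (intD _ DDQ).
have i21 := integrable_obsY lebXYE (pdfD _ DDPh) PhE2 (intD _ DDPh).
have treatedE (nu : probability (Obs R d) R) :
  nu [set o | obsT o = true] = censored nu [set w | w.1.2 = true] by [].
apply: meanN.
rewrite (mean_yE lebXYE (pdfD _ DDP) PE1 (intD _ DDP)).
rewrite (mean_yE lebXYE (pdfD _ DDQ) QE2 (intD _ DDQ)).
(* With almost nobody treated, E[Y(0)] equals its part over {T = 0}, which the common censored law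
   fixes for both studies. *)
have [T0|T0] := eqVneq (mu1 [set o | obsT o = true]) 0.
  have int0 (nu : probability (Obs R d) R) : nu [set o | obsT o = true] = 0 ->
      \int[nu]_(o in [set o | obsT o = true]) (obsY false o)%:E = 0.
    apply: null_set_integral; first exact: measurable_treated.
    by apply: measurable_funTS; apply/measurable_EFinP; exact: measurable_obsY.
  by rewrite !integral_obsY_split// !int0 ?cE// treatedE -cE -treatedE.
have F1 : (0 < mu1 [set o | obsT o = true]) by rewrite lt0e T0/=.
have F2 : (0 < mu2 [set o | obsT o = true]) by rewrite treatedE -cE -treatedE.
have : att mu1 = att mu2.
  rewrite -fE; last by split=> //; exists p, ph, P, Ph.
  by rewrite cE fE//; split=> //; exists q, ph, Q, Ph.
have mu2N0 : fine (mu2 [set o | obsT o = true]) != 0%R.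
  by rewrite fine_eq0 ?gt_eqF//; apply: fin_num_measure; exact: measurable_treated.
(* In [attE] the two studies share every term but E[Y(0)]; cancelling the nonzero denominator and
   the common terms equates the means. *)
rewrite !attE// cE -treatedE => /(mulIf (invr_neq0 mu2N0))/addrI/oppr_inj/addIr finE.
rewrite -[LHS]fineK; last exact: integrable_fin_num.
by rewrite finE fineK//; exact: integrable_fin_num.
Qed.

End identifiability_to_condition.

Theorem theorem1p2 (R : realType) (d : nat) (PP DD : set (CovOut R d -> R))
  (HPP : forall p, PP p -> forall z, 0 <= p z <= 1)
  (HDD : forall P, DD P -> is_pdf P)
  (HDDint : forall P, DD P -> (\int[@lebXY R d]_z (`|z.2| * P z)%:E < +oo)%E) :
  att_identifiable
    [set mu : probability (Obs R d) R |
      realizable PP DD mu /\ (0 < mu [set o | obsT o = true])%E]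
  <-> identifiability_condition PP DD.
Proof.
have [lam lamE] := @lebesgue_measure_borel R.
have [m mE] := lebXY_measure lamE d.
by split; [exact: (identifiable_condition mE)|exact: (condition_identifiable mE)].
Qed.
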